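(* Let $a^*(\tau):=\Big[5(1+2\tau\sqrt\Delta)\sqrt{1+\frac1{2\kappa}\min\{\frac1{\sqrt\Delta},\tau\}}\Big]^{-1}$. For every constant $K>0$ there are constants $c,C>0$ depending only on $K$ (not on $n,d,\kappa,\Delta,\tau,\gamma$ or the $f_i$) such that, if $\tau\le K\min\{\frac{1}{\sqrt\Delta},\kappa\}$, then: (i) for any step size $0<\gamma\le\frac{a^*(\tau)}{L}$, HOGWILD converges geometrically, with rate factor $\rho=\frac{\gamma\mu}{2}$, to a ball of radius $r_h\le C\frac{\gamma\sigma^2}{\mu}$ (in squared distance), i.e. for all $t\ge0$ $$\mathbb{E}\|\hat x_t-x^*\|^2\le\Big(1-\frac{\gamma\mu}{2}\Big)^t\,2\|x_0-x^*\|^2+C\,\frac{\gamma\sigma^2}{\mu};$$ so that, up to constant factors, rate and radius are those of serial SGD with the same step size and HOGWILD is linearly faster than its sequential counterpart up to a constant factor; (ii) $a^*(\tau)\ge c$, so that the range of step sizes in (i) is, up to a constant factor, that of serial SGD (step sizes of order $\frac1L$), and a universal step size $\gamma=\frac cL$ (not depending on $\kappa$) can be used in (i).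
   Context: Let $f(x)=\frac1n\sum_{i=1}^n f_i(x)$ on $\mathbb{R}^d$, where each $f_i$ is convex and differentiable with $L$-Lipschitz gradient $f_i'$, and $f$ is $\mu$-strongly convex ($\mu>0$). Let $\kappa:=L/\mu$, let $x^*$ be the minimizer of $f$, and let $\sigma^2:=\frac1n\sum_{i=1}^n\|f_i'(x^* )\|^2$. $[x]_v$ denotes coordinate $v$ of $x$. For each $i$, $S_i\subseteq\{1,\dots,d\}$ is the support of $f_i'$, i.e. the set of coordinates where $f_i'$ can be nonzero. The sparsity constant is $\Delta:=\frac1n\max_{v}|\{i:v\in S_i\}|\in[\frac1n,1]$. HOGWILD (asynchronous parallel constant-step-size SGD, step size $\gamma$). Shared memory holds $x\in\mathbb{R}^d$, initialized at a deterministic $x_0$. Several cores repeat in parallel, without locks: read all coordinates of $x$ (possibly inconsistently, i.e. coordinates are read at different times while other cores write), giving $\hat x$; sample $i$ uniformly in $\{1,\dots,n\}$; for each $v\in S_i$ atomically do $[x]_v\leftarrow[x]_v-\gamma[f_i'(\hat x)]_v$. Labeling (''after read''): iterations are labeled $t=0,1,2,\dots$ in the order in which their reads are completed; $\hat x_t$, $i_t$ are the read vector and sampled index of iteration $t$, and $g_t:=f_{i_t}'(\hat x_t)$. $i_t$ is uniform on $\{1,\dots,n\}$ and independent of everything in the past of the completed read $t$ (all $\hat x_u$, $u\le t$, and all $i_u$, $u<t$). Bounded overlap assumption with constant $\tau\ge0$ (integer): an iteration is being processed from the start of its read to the end of its writes, and iterations $r$ and $t$ are never processed concurrently when $r\ge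 t+\tau+1$; thus all coordinate writes of iteration $t$ are in memory before iteration $t+\tau+1$ starts. Hence, with virtual iterates $x_{t+1}:=x_t-\gamma g_t$ (starting from $x_0$), one has $\hat x_t-x_t=\gamma\sum_{u=(t-\tau)_+}^{t-1}G_u^tg_u$, where $G_u^t$ are (random) diagonal matrices with entries in $\{0,1\}$. For comparison, serial SGD with step size $\gamma\le\frac1{2L}$ satisfies $\mathbb{E}\|x_t-x^*\|^2\le(1-\gamma\mu)^t\|x_0-x^*\|^2+\frac{2\gamma\sigma^2}{\mu}$. *)

(* Defs.v *)
From HB Require Import structures.
From mathcomp Require Import all_boot all_order all_algebra.
From mathcomp Require Import all_classical all_reals all_analysis.

Set Implicit Arguments.
Unset Strict Implicit.
Unset Printing Implicit Defensive.

Import Order.TTheory GRing.Theory Num.Theory.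
Import numFieldNormedType.Exports.

Local Open Scope classical_set_scope.
Local Open Scope ring_scope.

(* The library norm on ['rV[R]_d] is the sup norm, hence explicit Euclidean
   norms here; differentiability does not depend on this choice. *)
Definition sqnorm (R : realType) (d : nat) (x : 'rV[R]_d) : R :=
  \sum_(v < d) x ord0 v ^+ 2.

Definition norm2 (R : realType) (d : nat) (x : 'rV[R]_d) : R :=
  Num.sqrt (sqnorm x).

Definition gradient (R : realType) (d : nat) (h : 'rV[R]_d -> R)
    (x : 'rV[R]_d) : 'rV[R]_d :=
  \row_(v < d) 'D_(delta_mx ord0 v) h x.

Definition strongly_convex (R : realType) (d : nat) (mu : R)
    (h : 'rV[R]_d -> R) : Prop :=
  forall (x y : 'rV[R]_d) (s : R), 0 <= s -> s <= 1 ->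
    h (s *: x + (1 - s) *: y) <=
      s * h x + (1 - s) * h y - mu / 2 * (s * (1 - s)) * sqnorm (x - y).

Definition objective (R : realType) (n d : nat) (f : 'I_n -> 'rV[R]_d -> R)
    (x : 'rV[R]_d) : R :=
  n%:R^-1 * \sum_(i < n) f i x.

Record finite_sum_problem (R : realType) (n d : nat)
    (f : 'I_n -> 'rV[R]_d -> R) (L mu : R) : Prop := {
  fsp_convex : forall i, convex_function [set: 'rV[R]_d] (f i) ;
  fsp_differentiable : forall i (x : 'rV[R]_d), differentiable (f i) x ;
  fsp_lipschitz : forall i (x y : 'rV[R]_d),
    norm2 (gradient (f i) x - gradient (f i) y) <= L * norm2 (x - y) ;
  fsp_mu_gt0 : 0 < mu ;
  fsp_strongly_convex : strongly_convex mu (objective f)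
}.

Definition is_minimizer (R : realType) (d : nat) (h : 'rV[R]_d -> R)
    (xs : 'rV[R]_d) : Prop :=
  forall x, h xs <= h x.

Definition grad_support (R : realType) (d : nat) (h : 'rV[R]_d -> R) :
    {set 'I_d} :=
  finset (fun v => `[< exists x : 'rV[R]_d, gradient h x ord0 v != 0 >]).

Definition sparsity (R : realType) (n d : nat) (f : 'I_n -> 'rV[R]_d -> R) : R :=
  (\max_(v < d) #|[pred i : 'I_n | v \in grad_support (f i)]|)%:R / n%:R.

Definition noise (R : realType) (n d : nat) (f : 'I_n -> 'rV[R]_d -> R)
    (xs : 'rV[R]_d) : R :=
  n%:R^-1 * \sum_(i < n) sqnorm (gradient (f i) xs).

Definition astar (R : realType) (kappa Delta : R) (tau : nat) : R :=
  (5 * (1 + 2 * tau%:R * Num.sqrt Delta)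
     * Num.sqrt (1 + 1 / (2 * kappa) *
                     Num.min (1 / Num.sqrt Delta) tau%:R))^-1.

(* Physical time stamps of the events of an asynchronous run: for iteration [t],
   the start of its read, the time at which coordinate [v] is read, the
   completion of its read, the time at which coordinate [v] is (atomically)
   written, and the end of its writes. [write_at t v] is meaningful only when
   [v] lies in the support of the gradient sampled by iteration [t]. *)
Record schedule (R : realType) (d : nat) := Schedule {
  read_start : nat -> R ;
  read_at : nat -> 'I_d -> R ;
  read_end : nat -> R ;
  write_at : nat -> 'I_d -> R ;
  write_end : nat -> R
}.

(* One realization of HOGWILD under the "after read" labeling. Each coordinate
   of [xhat t] is the content of the shared memory at the instant where that
   coordinate is read, i.e. the initial value plus all increments already
   written. Only iterations [u < t] can have written by then: iteration
   [u >= t] writes after [read_end u >= read_end t >= read_at t v]. *)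
Record hogwild_run (R : realType) (n d : nat) (f : 'I_n -> 'rV[R]_d -> R)
    (gamma : R) (x0 : 'rV[R]_d) (s : schedule R d)
    (xhat : nat -> 'rV[R]_d) (idx : nat -> 'I_n) : Prop := {
  run_read : forall t v,
    read_start s t <= read_at s t v /\ read_at s t v <= read_end s t ;
  run_read_write_end : forall t, read_end s t <= write_end s t ;
  run_write : forall t v, v \in grad_support (f (idx t)) ->
    read_end s t <= write_at s t v /\ write_at s t v <= write_end s t ;
  run_labeling : forall t u, (t <= u)%N -> read_end s t <= read_end s u ;
  run_memory : forall t v,
    xhat t ord0 v = x0 ord0 v -
      \sum_(u < t | (v \in grad_support (f (idx u)))
                    && (write_at s u v < read_at s t v))
        gamma * gradient (f (idx u)) (xhat u) ord0 v
}.

(* Iteration [t] is being processed during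
   [[read_start t, write_end t]]; these intervals must be disjoint. *)
Definition bounded_overlap (R : realType) (d : nat) (tau : nat)
    (s : schedule R d) : Prop :=
  forall t r, (t + tau + 1 <= r)%N ->
    write_end s t < read_start s r \/ write_end s r < read_start s t.

(* Generators of the sigma-algebra of [xhat u], [u <= t], and [idx u], [u < t]. *)
Definition past_events (R : realType) (n d : nat) (T : Type)
    (xhat : nat -> T -> 'rV[R]_d) (idx : nat -> T -> 'I_n) (t : nat) :
    set (set T) :=
  [set A | (exists (u : nat) (v : 'I_d) (B : set R),
              [/\ (u <= t)%N, measurable B &
                  A = [set w | B (xhat u w ord0 v)]])
        \/ (exists (u : nat) (j : 'I_n),
              (u < t)%N /\ A = [set w | idx u w = j])].

Record uniform_sampling (R : realType) (n d : nat) (disp : measure_display)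
    (T : measurableType disp) (P : probability T R)
    (xhat : nat -> T -> 'rV[R]_d) (idx : nat -> T -> 'I_n) : Prop := {
  samp_xhat_measurable : forall t v,
    measurable_fun [set: T] (fun w => xhat t w ord0 v) ;
  samp_idx_measurable : forall t j, measurable [set w | idx t w = j] ;
  samp_uniform : forall t j, P [set w | idx t w = j] = (n%:R^-1)%:E ;
  samp_independent : forall t j (A : set T), <<s past_events xhat idx t >> A ->
    P (A `&` [set w | idx t w = j]) = (P A * P [set w | idx t w = j])%E
}.

(* Neither the number of cores nor the law of the schedule is constrained: the
   schedule may depend arbitrarily on the outcome, [idx] included. *)
Record hogwild (R : realType) (n d : nat) (disp : measure_display)
    (T : measurableType disp) (P : probability T R)
    (f : 'I_n -> 'rV[R]_d -> R) (gamma : R) (tau : nat) (x0 : 'rV[R]_d)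
    (s : T -> schedule R d)
    (xhat : nat -> T -> 'rV[R]_d) (idx : nat -> T -> 'I_n) : Prop := {
  hogwild_runs : forall w,
    hogwild_run f gamma x0 (s w) (fun t => xhat t w) (fun t => idx t w) ;
  hogwild_overlap : forall w, bounded_overlap tau (s w) ;
  hogwild_sampling : uniform_sampling P xhat idx
}.

(* Main.v *)
(* Reads take finitely many values, so all expectations up to a given iteration
   are finite sums over a finite space of histories. Along the virtual iterates
   x_t, expanding |x_{t+1} - x*|^2 leaves the error terms
   2 gamma <xhat_t - x_t, g_t> and gamma mu |xhat_t - x_t|^2; as i_t is
   independent of the past, sparsity gives
   E sum_v |g_u|_v |g_t|_v <= sqrt(Delta) / 2 (E|g_u|^2 + E|g_t|^2) for u < t, and
   both terms are controlled by the E|g_u|^2 in a window of length tau. By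
   E|g_u|^2 <= 4 L E(f(xhat_u) - min f) + 2 sigma^2, they are absorbed by the
   decrease - 2 gamma E(f(xhat_t) - min f) through a Lyapunov function adding to
   E|x_t - x*|^2 the past E|g_u|^2 with weights linear in the delay.
   Strong convexity along one coordinate gives mu <= Delta L, i.e.
   kappa >= 1 / Delta: hence gamma mu tau <= 1 / 10 for every admissible step
   size, whatever K is, and the square root in a* is bounded. *)
Require Import Defs.
From HB Require Import structures.
From mathcomp Require Import all_boot all_order all_algebra.
From mathcomp Require Import ring lra.
From mathcomp Require Import all_classical all_reals all_analysis.
From mathcomp Require Import measurable_realfun.

Set Implicit Arguments.
Unset Strict Implicit.
Unset Printing Implicit Defensive.

Import Order.TTheory GRing.Theory Num.Theory.
Import numFieldNormedType.Exports.

Local Open Scope classical_set_scope.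
Local Open Scope ring_scope.

(** * Convexity and smoothness *)

Section inner_product.
Variables (R : realType) (d : nat).
Implicit Types (x y z : 'rV[R]_d) (k : R).

Definition dotv x y : R := \sum_(v < d) x ord0 v * y ord0 v.

Lemma dotvC x y : dotv x y = dotv y x.
Proof. by apply: eq_bigr => v _; rewrite mulrC. Qed.

Lemma dotvDl x y z : dotv (x + y) z = dotv x z + dotv y z.
Proof. by rewrite -big_split/=; apply: eq_bigr => v _; rewrite mxE mulrDl. Qed.

Lemma dotvZl k x z : dotv (k *: x) z = k * dotv x z.
Proof. by rewrite mulr_sumr; apply: eq_bigr => v _; rewrite mxE mulrA. Qed.

Lemma dotvNl x z : dotv (- x) z = - dotv x z.
Proof. by rewrite -scaleN1r dotvZl mulN1r. Qed.

Lemma dotvBl x y z : dotv (x - y) z = dotv x z - dotv y z.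
Proof. by rewrite dotvDl dotvNl. Qed.

Lemma dotvDr x y z : dotv z (x + y) = dotv z x + dotv z y.
Proof. by rewrite dotvC dotvDl !(dotvC z). Qed.

Lemma dotvZr k x z : dotv z (k *: x) = k * dotv z x.
Proof. by rewrite dotvC dotvZl dotvC. Qed.

Lemma dotvNr x z : dotv z (- x) = - dotv z x.
Proof. by rewrite dotvC dotvNl dotvC. Qed.

Lemma dotvBr x y z : dotv z (x - y) = dotv z x - dotv z y.
Proof. by rewrite dotvC dotvBl !(dotvC z). Qed.

Lemma dotv_suml (I : Type) (r : seq I) (P : pred I) (F : I -> 'rV[R]_d) z :
  dotv (\sum_(i <- r | P i) F i) z = \sum_(i <- r | P i) dotv (F i) z.
Proof.
apply: (big_morph (fun x => dotv x z) (fun x y => dotvDl x y z)).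
by rewrite /dotv big1 // => v _; rewrite mxE mul0r.
Qed.

Lemma sqnormE x : sqnorm x = dotv x x.
Proof. by apply: eq_bigr => v _; rewrite expr2. Qed.

Lemma sqnorm_ge0 x : 0 <= sqnorm x.
Proof. by apply: sumr_ge0 => v _; rewrite sqr_ge0. Qed.

Lemma norm2_ge0 x : 0 <= norm2 x.
Proof. exact: sqrtr_ge0. Qed.

Lemma sqr_norm2 x : norm2 x ^+ 2 = sqnorm x.
Proof. by rewrite sqr_sqrtr ?sqnorm_ge0. Qed.

Lemma sqnorm0_eq0 x : sqnorm x = 0 -> x = 0.
Proof.
move=> /eqP; rewrite psumr_eq0; last by move=> v _; rewrite sqr_ge0.
move=> /allP x0; apply/rowP => v; rewrite mxE.
by apply/eqP; rewrite -(sqrf_eq0 (x ord0 v)); apply: x0; rewrite mem_index_enum.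
Qed.

Lemma sqnormN x : sqnorm (- x) = sqnorm x.
Proof. by apply: eq_bigr => v _; rewrite mxE sqrrN. Qed.

Lemma sqnormZ k x : sqnorm (k *: x) = k ^+ 2 * sqnorm x.
Proof. by rewrite !sqnormE dotvZl dotvZr; ring. Qed.

Lemma sqnormD x y : sqnorm (x + y) = sqnorm x + 2 * dotv x y + sqnorm y.
Proof. by rewrite !sqnormE !dotvDl !dotvDr (dotvC y x); ring. Qed.

Lemma sqnormB x y : sqnorm (x - y) = sqnorm x - 2 * dotv x y + sqnorm y.
Proof. by rewrite !sqnormE !dotvBl !dotvBr (dotvC y x); ring. Qed.

Lemma sqnormD_le x y : sqnorm (x + y) <= 2 * (sqnorm x + sqnorm y).
Proof. by have := sqnorm_ge0 (x - y); rewrite sqnormB sqnormD; lra. Qed.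

Lemma sqnormB_le x y : sqnorm (x - y) <= 2 * (sqnorm x + sqnorm y).
Proof. by rewrite -(sqnormN y) sqnormD_le. Qed.

Lemma dotv_young x y k : 0 < k -> dotv x y <= k / 2 * sqnorm x + sqnorm y / (2 * k).
Proof.
move=> k0; have := sqnorm_ge0 (k *: x - y).
rewrite sqnormB sqnormZ dotvZl => h.
have -> : k / 2 * sqnorm x + sqnorm y / (2 * k) =
   dotv x y + (k ^+ 2 * sqnorm x - 2 * (k * dotv x y) + sqnorm y) / (2 * k).
  by field; rewrite gt_eqF.
by rewrite lerDl divr_ge0 // mulr_ge0 // ltW.
Qed.

(** Young's inequality with [k] the ratio of the norms, which makes its two terms equal; zero
    vectors are treated apart. *)
Lemma dotv_le_norm2 x y : dotv x y <= norm2 x * norm2 y.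
Proof.
have [|x0] := eqVneq (norm2 x) 0.
  move=> x0; have /sqnorm0_eq0 -> : sqnorm x = 0 by rewrite -sqr_norm2 x0 expr0n.
  rewrite -[X in dotv X _](scale0r (0 : 'rV[R]_d)) dotvZl mul0r.
  by rewrite mulr_ge0 ?norm2_ge0.
have [|y0] := eqVneq (norm2 y) 0.
  move=> y0; have /sqnorm0_eq0 -> : sqnorm y = 0 by rewrite -sqr_norm2 y0 expr0n.
  rewrite -[X in dotv _ X](scale0r (0 : 'rV[R]_d)) dotvZr mul0r.
  by rewrite mulr_ge0 ?norm2_ge0.
have xp : 0 < norm2 x by rewrite lt_def x0 norm2_ge0.
have yp : 0 < norm2 y by rewrite lt_def y0 norm2_ge0.
apply: le_trans (dotv_young x y (divr_gt0 yp xp)) _.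
rewrite -!sqr_norm2 le_eqVlt; apply/orP; left; apply/eqP.
by field; rewrite x0 y0.
Qed.

Lemma norm2_coord_le x v : `|x ord0 v| <= norm2 x.
Proof.
rewrite -sqrtr_sqr ler_sqrt ?sqnorm_ge0 // /sqnorm (bigD1 v) //= lerDl.
by apply: sumr_ge0 => i _; rewrite sqr_ge0.
Qed.

Lemma sqnorm_delta v : sqnorm (delta_mx ord0 v : 'rV[R]_d) = 1.
Proof.
rewrite /sqnorm (bigD1 v) //= big1 ?addr0 ?mxE ?eqxx ?expr1n // => i iv.
by rewrite mxE eqxx (negbTE iv) expr0n.
Qed.

Lemma norm2_delta v : norm2 (delta_mx ord0 v : 'rV[R]_d) = 1.
Proof. by rewrite /norm2 sqnorm_delta sqrtr1. Qed.

Lemma dotv_delta x v : dotv x (delta_mx ord0 v) = x ord0 v.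
Proof.
rewrite /dotv (bigD1 v) //= big1 ?addr0 ?mxE ?eqxx ?mulr1 // => i iv.
by rewrite mxE eqxx (negbTE iv) mulr0.
Qed.

End inner_product.

(** * First-order inequalities for one smooth convex function *)

Section smooth_convex.
Variables (R : realType) (d : nat) (h : 'rV[R]_d -> R).
Hypothesis dh : forall x, differentiable h x.
Implicit Types x y z : 'rV[R]_d.

Lemma derive_gradient x z : 'D_z h x = dotv (gradient h x) z.
Proof.
rewrite deriveE // {1}(row_sum_delta z) linear_sum /=.
apply: eq_bigr => v _.
by rewrite linearZ /= mxE deriveE // mulrC.
Qed.

Lemma is_derive_line x z (s : R) :
  is_derive s 1 (fun s => h (s *: z + x)) (dotv (gradient h (s *: z + x)) z).
Proof.
have E : (fun k : R => k^-1 *: (((fun s => h (s *: z + x)) \o shift s) (k *: 1)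
     - h (s *: z + x))) =
   (fun k => k^-1 *: ((h \o shift (s *: z + x)) (k *: z) - h (s *: z + x))).
  apply: funext => k /=; congr (_ *: (h _ - _)).
  by rewrite [k *: 1]mulr1 scalerDl addrA.
have dz := @diff_derivable _ _ _ _ _ z (dh (s *: z + x)).
split; first by move: dz; rewrite /derivable E.
by rewrite /derive E -derive_gradient.
Qed.

(** The mean value theorem, applied to [h] along the segment minus a quadratic [p], replaces an
    integral of the gradient: the Lipschitz bound makes the derivative of [phi] nonpositive, and [p]
    carries the sharp constant [L / 2]. *)
Lemma smooth_upper_bound (L : R) x y :
  (forall u w, norm2 (gradient h u - gradient h w) <= L * norm2 (u - w)) ->
  h y <= h x + dotv (gradient h x) (y - x) + L / 2 * sqnorm (y - x).
Proof.
move=> lip; set z := y - x.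
pose D0 := dotv (gradient h x) z.
pose p := D0 *: 'X + (L / 2 * sqnorm z) *: 'X^2.
pose phi s := h (s *: z + x) - p.[s].
have dphi (s : R) : is_derive s 1 phi (dotv (gradient h (s *: z + x)) z
   - (D0 + 2 * s * (L / 2 * sqnorm z))).
  have -> : D0 + 2 * s * (L / 2 * sqnorm z) = p^`().[s].
    by rewrite /p !poly.derivE !hornerE /=; ring.
  by apply: is_deriveB; first exact: is_derive_line.
have cphi : {within `[0, 1], continuous phi}.
  apply: continuous_subspaceT => s; apply: differentiable_continuous.
  by apply/derivable1_diffP; have [] := dphi s.
have [c c01 E] := MVT ltr01 (fun s _ => dphi s) cphi.
have pE s : p.[s] = s * D0 + s ^+ 2 * (L / 2 * sqnorm z).
  by rewrite /p hornerD !hornerZ hornerXn hornerX; ring.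
move: E; rewrite subr0 mulr1 /phi !pE scale1r scale0r add0r subrK.
suff : dotv (gradient h (c *: z + x)) z - D0 <= c * (L * sqnorm z).
  rewrite -/D0 => + E; lra.
rewrite -dotvBl; apply: le_trans (dotv_le_norm2 _ _) _.
apply: le_trans (ler_wpM2r (norm2_ge0 _) (lip _ _)) _.
rewrite addrK -sqr_norm2 expr2 !mulrA ler_wpM2r ?norm2_ge0 //.
rewrite /norm2 sqnormZ sqrtrM ?sqr_ge0 // sqrtr_sqr ger0_norm.
  by rewrite [c * L]mulrC mulrA.
by move: c01; rewrite in_itv /= => /andP[/ltW].
Qed.

Hypothesis convh : convex_function [set: 'rV[R]_d] h.

(** Convexity bounds the difference quotient from [x] towards [y] by [h y - h x] for positive steps
    up to 1 only, so the derivative is taken as a limit from the right. *)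
Lemma convex_lower_bound x y : h x + dotv (gradient h x) (y - x) <= h y.
Proof.
rewrite -lerBrDl -derive_gradient.
have dz := @diff_derivable _ _ _ _ _ (y - x) (dh x).
have hc : k^-1 *: ((h \o shift x) (k *: (y - x)) - h x) @[k --> (0 : R)^'+]
    --> 'D_(y - x) h x by exact/cvg_dnbhs_at_right/dz.
apply: (cvgr_to_le hc).
near=> k.
have k0 : 0 < k by near: k; exact: nbhs_right_gt.
have k1 : k <= 1 by apply: ltW; near: k; exact: nbhs_right_lt.
have := convh (Itv01 (ltW k0) k1) (in_setT y) (in_setT x).
rewrite convRE /= /conv /= /unstable.onem => hk.
rewrite [_ *: _]mulrC ler_pdivrMr //.
have -> : k *: (y - x) + x = k *: y + (1 - k) *: x.
  by rewrite scalerBr scalerBl scale1r -!addrA [- _ + x]addrC.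
apply: le_trans (lerB hk (lexx (h x))) _.
by rewrite le_eqVlt; apply/orP; left; apply/eqP; ring.
Unshelve. all: by end_near.
Qed.

(** At [x - L^-1 *: g], which minimizes the quadratic upper model of [h] at [x] minus the tangent at
    [y], that upper model still lies above the tangent. *)
Lemma smooth_convex_gradient (L : R) x y : 0 < L ->
  (forall u w, norm2 (gradient h u - gradient h w) <= L * norm2 (u - w)) ->
  sqnorm (gradient h x - gradient h y) <=
    2 * L * (h x - h y - dotv (gradient h y) (x - y)).
Proof.
move=> L0 lip; set g := gradient h x - gradient h y.
have := smooth_upper_bound x (x - L^-1 *: g) lip.
have := convex_lower_bound y (x - L^-1 *: g).
rewrite [x - _ - x]addrAC subrr sub0r sqnormN sqnormZ.
rewrite [x - _ - y]addrAC [dotv (gradient h y) _]dotvBr.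
rewrite dotvNr !dotvZr => lo up.
have gE : dotv (gradient h x) g - dotv (gradient h y) g = sqnorm g.
  by rewrite -dotvBl -sqnormE.
have {lo up} := le_trans lo up.
rewrite -subr_ge0 => le0.
rewrite -subr_ge0.
have -> : 2 * L * (h x - h y - dotv (gradient h y) (x - y)) - sqnorm g =
  2 * L * (h x - L^-1 * dotv (gradient h x) g + L / 2 * (L^-1 ^+ 2 * sqnorm g)
   - (h y + (dotv (gradient h y) (x - y) - L^-1 * dotv (gradient h y) g))).
  rewrite -gE; field; lra.
by rewrite mulr_ge0 // mulr_ge0 // ltW.
Qed.
End smooth_convex.

(** * The averaged objective and its sparsity constant *)

Section finite_sum.
Variables (R : realType) (n d : nat) (f : 'I_n -> 'rV[R]_d -> R) (L mu : R).
Hypotheses (n0 : (0 < n)%N) (d0 : (0 < d)%N) (fsp : finite_sum_problem f L mu).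
Implicit Types x y z : 'rV[R]_d.

(** Bounds for [objective f] are averages of those for the [f i], so its gradient enters only as
    this average of gradients. *)
Definition mean_gradient x : 'rV[R]_d := n%:R^-1 *: \sum_(i < n) gradient (f i) x.

Let ninv_ge0 : 0 <= n%:R^-1 :> R. Proof. by rewrite invr_ge0 ler0n. Qed.

Let nN0 : n%:R != 0 :> R. Proof. by rewrite pnatr_eq0 -lt0n. Qed.

Lemma dotv_mean_gradient x z :
  dotv (mean_gradient x) z = n%:R^-1 * \sum_(i < n) dotv (gradient (f i) x) z.
Proof. by rewrite dotvZl dotv_suml. Qed.

Lemma mean_const (c : R) : n%:R^-1 * \sum_(i < n) c = c.
Proof. by rewrite sumr_const card_ord -[c *+ n]mulr_natl mulrA mulVf // mul1r. Qed.

Lemma objective_lower_bound x y :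
  objective f x + dotv (mean_gradient x) (y - x) <= objective f y.
Proof.
rewrite dotv_mean_gradient /objective -mulrDr -big_split /= ler_wpM2l //.
apply: ler_sum => i _; apply: convex_lower_bound => [z|].
  exact: (fsp_differentiable fsp).
exact: (fsp_convex fsp).
Qed.

Lemma objective_upper_bound x y :
  objective f y <=
    objective f x + dotv (mean_gradient x) (y - x) + L / 2 * sqnorm (y - x).
Proof.
rewrite dotv_mean_gradient /objective -[L / 2 * _]mean_const -!mulrDr.
rewrite -!big_split /= ler_wpM2l //; apply: ler_sum => i _.
apply: smooth_upper_bound => [z|]; first exact: (fsp_differentiable fsp).
exact: (fsp_lipschitz fsp).
Qed.

Lemma objective_strong_lower_bound x y :
  objective f x + dotv (mean_gradient x) (y - x) + mu / 2 * sqnorm (y - x)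
    <= objective f y.
Proof.
set A := objective f x + _; set B := mu / 2 * _; set C := objective f y.
have B0 : 0 <= B by rewrite mulr_ge0 ?sqnorm_ge0 // divr_ge0 // ltW // (fsp_mu_gt0 fsp).
(* The gradient inequality at [s *: y + (1 - s) *: x] is set against strong convexity and divided by
   [s]; the claim is the limit as [s] tends to 0. *)
have key s : 0 < s -> s <= 1 -> A + B - C <= s * B.
  move=> s0 s1.
  have sc := fsp_strongly_convex fsp y x (ltW s0) s1.
  have := objective_lower_bound x (s *: y + (1 - s) *: x).
  have -> : s *: y + (1 - s) *: x - x = s *: (y - x).
    by rewrite scalerBr scalerBl scale1r [x - _]addrC addrA addrK.
  rewrite dotvZr => lo; rewrite -(ler_pM2l s0).
  have := le_trans lo sc; rewrite /A /B /C => {}lo.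
  nra.
rewrite leNgt; apply/negP => AC.
have [B00|Bn] := eqVneq B 0.
  by have := key 1 ltr01 (lexx _); rewrite B00; lra.
have Bp : 0 < B by rewrite lt_def Bn.
(* For this [s], [s * B] is at most half of [A + B - C], which contradicts its positivity. *)
pose s := Num.min 1 ((A + B - C) / (2 * B)).
have e0 : 0 < A + B - C by lra.
have s0 : 0 < s by rewrite lt_min ltr01 divr_gt0 // mulr_gt0.
have s1 : s <= 1 by rewrite ge_min lexx.
have := key s s0 s1.
have : s * B <= (A + B - C) / (2 * B) * B by rewrite ler_wpM2r // ge_min lexx orbT.
have -> : (A + B - C) / (2 * B) * B = (A + B - C) / 2 by field.
lra.
Qed.

Lemma lipschitz_ge0 : 0 <= L.
Proof.
have := fsp_lipschitz fsp (Ordinal n0) (delta_mx ord0 (Ordinal d0)) 0.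
by rewrite subr0 norm2_delta mulr1; apply: le_trans; exact: norm2_ge0.
Qed.

Lemma gradient_eq0 i x v : v \notin grad_support (f i) -> gradient (f i) x ord0 v = 0.
Proof.
rewrite inE => /asboolPn h; apply/eqP/negPn/negP => g0.
by apply: h; exists x.
Qed.

Lemma sparsity_count_le (v : 'I_d) :
  n%:R^-1 * \sum_(i < n) (v \in grad_support (f i))%:R <= sparsity f.
Proof.
rewrite /sparsity mulrC ler_wpM2r // -natr_sum ler_nat.
apply: leq_trans (leq_bigmax v).
rewrite -sum1_card [leqRHS]big_mkcond /=; apply: leq_sum => i _.
have -> : (i \in [pred i | v \in grad_support (f i)]) = (v \in grad_support (f i)).
  by [].
by case: (v \in _).
Qed.

Lemma sparsity_le1 : sparsity f <= 1.
Proof.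
rewrite /sparsity ler_pdivrMr ?ltr0n // mul1r ler_nat.
by apply/bigmax_leqP => v _; rewrite -[leqRHS]card_ord max_card.
Qed.

(* Restricting strong convexity to a coordinate line, where only the [f i]
   whose support contains that coordinate vary. *)
Lemma strong_convexity_le_sparsity : mu <= sparsity f * L.
Proof.
pose v := Ordinal d0; pose e := delta_mx ord0 v : 'rV[R]_d.
have h1 := objective_strong_lower_bound 0 e.
have h2 := objective_strong_lower_bound e 0.
move: h1 h2; rewrite subr0 sub0r sqnormN sqnorm_delta !mulr1.
rewrite dotvNr /e !dotv_delta => h1 h2.
have : mu <= mean_gradient e ord0 v - mean_gradient 0 ord0 v by rewrite /e; lra.
move=> /le_trans; apply.
rewrite !mxE !summxE -mulrBr -sumrB.
apply: le_trans (ler_wpM2r lipschitz_ge0 (sparsity_count_le v)).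
rewrite -mulrA ler_wpM2l // mulr_suml; apply: ler_sum => i _.
have [vi|vi] := boolP (v \in grad_support (f i)); last first.
  by rewrite !gradient_eq0 // subrr mul0r.
rewrite mul1r; apply: le_trans (ler_norm _) _.
have := norm2_coord_le (gradient (f i) e - gradient (f i) 0) v.
rewrite !mxE => /le_trans; apply.
by apply: le_trans (fsp_lipschitz fsp i e 0) _; rewrite subr0 norm2_delta mulr1.
Qed.

Lemma sparsity_ge0 : 0 <= sparsity f.
Proof. by rewrite /sparsity mulr_ge0 ?ler0n. Qed.

Lemma sparsity_gt0 : 0 < sparsity f.
Proof.
rewrite lt_def sparsity_ge0 andbT; apply/eqP => s0.
have := strong_convexity_le_sparsity.
by rewrite s0 mul0r leNgt (fsp_mu_gt0 fsp).
Qed.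

Lemma lipschitz_gt0 : 0 < L.
Proof.
rewrite lt_def lipschitz_ge0 andbT; apply/eqP => s0.
have := strong_convexity_le_sparsity.
by rewrite s0 mulr0 leNgt (fsp_mu_gt0 fsp).
Qed.

(** A gradient step of size [L^-1] from [xs] would lower the objective by at least
    [sqnorm g / (2 * L)]. *)
Lemma mean_gradient_minimizer xs :
  is_minimizer (objective f) xs -> mean_gradient xs = 0.
Proof.
move=> xsmin; apply: sqnorm0_eq0; apply/eqP.
rewrite eq_le sqnorm_ge0 andbT; set g := mean_gradient xs.
have L0 := lipschitz_gt0.
have := le_trans (xsmin _) (objective_upper_bound xs (xs - L^-1 *: g)).
rewrite [xs - _ - xs]addrAC subrr sub0r sqnormN sqnormZ -/g dotvNr dotvZr -sqnormE.
have -> : L / 2 * (L^-1 ^+ 2 * sqnorm g) = L^-1 * sqnorm g / 2.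
  by field; rewrite gt_eqF.
move=> h; have : L^-1 * sqnorm g <= 0 by lra.
by rewrite pmulr_rle0 // invr_gt0.
Qed.

(** Each gradient is split into its value at [xs] and its increment from there. The increment is
    bounded by [smooth_convex_gradient], whose linear terms average to zero because the mean
    gradient vanishes at [xs]. *)
Lemma mean_sqnorm_gradient_le xs x : is_minimizer (objective f) xs ->
  n%:R^-1 * \sum_(i < n) sqnorm (gradient (f i) x) <=
    4 * L * (objective f x - objective f xs) + 2 * noise f xs.
Proof.
move=> /mean_gradient_minimizer g0.
have : dotv (mean_gradient xs) (x - xs) = 0.
  by rewrite g0 -[X in dotv X _](scale0r (0 : 'rV[R]_d)) dotvZl mul0r.
rewrite dotv_mean_gradient => E0.
have -> : 4 * L * (objective f x - objective f xs) + 2 * noise f xs =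
  n%:R^-1 * \sum_(i < n) (4 * L * (f i x - f i xs - dotv (gradient (f i) xs) (x - xs))
    + 2 * sqnorm (gradient (f i) xs)).
  rewrite big_split /= -!mulr_sumr !sumrB /= /noise /objective.
  by move: E0; set D := \sum_(i < n) dotv _ _ => E0; ring: E0.
rewrite ler_wpM2l //; apply: ler_sum => i _.
have h := smooth_convex_gradient (fsp_differentiable fsp i) (fsp_convex fsp i) x xs
  lipschitz_gt0 (fsp_lipschitz fsp i).
have E : gradient (f i) x = gradient (f i) x - gradient (f i) xs + gradient (f i) xs.
  by rewrite subrK.
have := sqnormD_le (gradient (f i) x - gradient (f i) xs) (gradient (f i) xs).
rewrite -E; lra.
Qed.

End finite_sum.

(** * The recursion on a finite probability space *)

Section delayed_recursion.
Variables (R : realType) (a q e : nat -> R) (rho c1 c2 A B E : R) (tau N : nat).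
Hypotheses (rho_gt0 : 0 < rho) (rho_le1 : rho <= 1) (rho_tau : rho * tau%:R <= 1 / 10).
Hypotheses (c1_ge0 : 0 <= c1) (c2_ge0 : 0 <= c2) (B_ge0 : 0 <= B).
Hypotheses (q_ge0 : forall t, 0 <= q t) (e_ge0 : forall t, 0 <= e t).
Hypothesis q_le : forall t, (t <= N)%N -> q t <= A * e t + B.
Hypothesis step : forall t, (t <= N)%N ->
  a t.+1 <= (1 - rho) * a t + c1 * q t
            + c2 * (\sum_(u < t | (t <= u + tau)%N) q u) - E * e t.

(** The drop [c2'] of the weight per unit of delay must pay for [c2], for [rho * c1] and for a
    discount of at most [rho * tau * c2']; as [rho * tau <= 1 / 10], the factor 10 / 9 suffices. *)
Let c2' := 10 / 9 * (c2 + rho * c1).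
(** Bounds the total coefficient of a new [q t] in one step of [V]: [c1] from the recursion and
    [w 1] from its entry into the sum. *)
Let M := 2 * c1 + tau%:R * c2'.
Hypothesis M_small : M * A <= E.

(** Within the window the weights stay at least [c1], so [V] also dominates [c1] times the window
    sum, which later pays for passing from virtual iterates to reads. *)
Let w j := if (j <= tau)%N then c1 + c2' * (tau.+1 - j)%:R else 0.
Let V t := a t + \sum_(u < t) w (t - u) * q u.

Let c2'_ge0 : 0 <= c2'.
Proof. by rewrite mulr_ge0 // addr_ge0 // mulr_ge0 // ltW. Qed.

Let M_ge0 : 0 <= M.
Proof. by rewrite /M addr_ge0 // mulr_ge0. Qed.

Let w_step j : (0 < j)%N -> w j.+1 + c2 * (j <= tau)%:R <= (1 - rho) * w j.
Proof.
move=> j0; rewrite /w; case: (leqP j tau) => jt; last first.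
  by rewrite ltnNge (ltnW jt) /= !mulr0 addr0.
have aux : c1 + c2' * (tau - j)%:R + c2 <= (1 - rho) * (c1 + c2' * (tau.+1 - j)%:R).
  rewrite subSn // -[(tau - j).+1]addn1 natrD.
  have x0 : 0 <= (tau - j)%:R :> R by rewrite ler0n.
  have xt : (tau - j)%:R + 1 <= tau%:R :> R.
    by rewrite natr1 ler_nat -subSn // leq_subLR addnC -addn1 leq_add2l.
  have : rho * ((tau - j)%:R + 1) <= 1 / 10.
    by apply: le_trans rho_tau; rewrite ler_wpM2l // ltW.
  have : c2' = 10 / 9 * (c2 + rho * c1) by [].
  move: c2'_ge0 x0; set x := (tau - j)%:R; set c := c2' => c0 x0 cE rx.
  have : c * (rho * (x + 1)) <= c * (1 / 10) by rewrite ler_wpM2l.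
  nra.
rewrite mulr1; case: ifP => [_|jt']; first by rewrite subSS.
apply: le_trans aux; rewrite lerD2r addr_ge0 // mulr_ge0 //.
Qed.

(** By [w_step] the discounted weights absorb the delayed sum. What remains is at most [M * q t],
    which [q_le] splits into [M * B] and a part absorbed by [- E * e t]. *)
Let V_step t : (t <= N)%N -> V t.+1 <= (1 - rho) * V t + M * B.
Proof.
move=> tN; rewrite /V big_ord_recr /= subSnn.
have w1 : w 1 <= c1 + tau%:R * c2'.
  rewrite /w; case: ifP => _; first by rewrite subSS subn0 mulrC.
  by rewrite addr_ge0 // mulr_ge0.
have h : \sum_(i < t) w (t.+1 - i) * q i
    + c2 * (\sum_(u < t | (t <= u + tau)%N) q u)
    <= (1 - rho) * \sum_(u < t) w (t - u) * q u.
  rewrite [X in c2 * X]big_mkcond /= !mulr_sumr -big_split /=.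
  apply: ler_sum => i _; rewrite mulrA.
  have it : (0 < t - i)%N by rewrite subn_gt0.
  apply: le_trans (ler_wpM2r (q_ge0 i) (w_step it)).
  rewrite mulrDl -subSn ?(ltnW (ltn_ord i)) // lerD2l leq_subLR.
  by case: ifP => _; rewrite ?mulr1 // !mulr0 mul0r.
have s := step tN; have qt := q_le tN; have q0 := q_ge0 t; have e0 := e_ge0 t.
have : (c1 + w 1) * q t <= M * (A * e t + B).
  apply: le_trans (_ : M * q t <= _).
    by rewrite ler_wpM2r // /M; lra.
  by rewrite ler_wpM2l.
have : M * A * e t <= E * e t by rewrite ler_wpM2r.
rewrite mulrDr; lra.
Qed.

(** Iterating [V_step] adds a geometric series bounded by [M * B / rho]; at time 0 there is no
    delayed term, so [V] equals [a]. *)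
Lemma delayed_recursion_bound t : (t <= N.+1)%N ->
  a t + c1 * (\sum_(u < t | (t <= u + tau)%N) q u)
    <= (1 - rho) ^+ t * a 0%N + M * B / rho.
Proof.
move=> tN; apply: (@le_trans _ _ (V t)).
  rewrite lerD2l mulr_sumr big_mkcond /=; apply: ler_sum => u _.
  rewrite /w leq_subLR; case: ifP => _; last by rewrite mul0r.
  by rewrite ler_wpM2r // lerDl mulr_ge0.
elim: t tN => [|t IH] tN.
  rewrite /V big_ord0 addr0 expr0 mul1r lerDl divr_ge0 ?(ltW rho_gt0) //.
  by rewrite mulr_ge0.
apply: le_trans (V_step tN) _.
have := IH (ltnW tN); move: (V t) => Vt; have r1 : 0 <= 1 - rho by rewrite subr_ge0.
move=> /(ler_wpM2l r1); rewrite [X in _ <= X]mulrDr mulrA -exprS.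
have -> : (1 - rho) * (M * B / rho) = M * B / rho - M * B.
  by field; rewrite gt_eqF.
lra.
Qed.

End delayed_recursion.

Lemma card_window (t tau : nat) : (#|[pred u : 'I_t | t <= u + tau]| <= tau)%N.
Proof.
rewrite -sum1_card -(big_mkord (fun u => (t <= u + tau)%N) (fun=> 1%N)).
rewrite (big_cat_nat (n := (t - tau)%N)) ?leq_subr //=.
rewrite big_nat_cond big1 ?add0n; last first.
  by move=> i /andP[/andP[_]]; rewrite ltn_subRL addnC ltnNge => /negP.
rewrite big_mkcond /=; apply: (@leq_trans (\sum_(t - tau <= i < t) 1)%N).
  by apply: leq_sum => i _; case: ifP.
by rewrite sum_nat_const_nat muln1 leq_subCl.
Qed.

(** * Moment bounds for HOGWILD on a finite space of histories *)

Section finite_hogwild.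
Variables (R : realType) (n d : nat) (f : 'I_n -> 'rV[R]_d -> R) (L mu : R).
Hypotheses (n0 : (0 < n)%N) (d0 : (0 < d)%N) (fsp : finite_sum_problem f L mu).
Variable xs : 'rV[R]_d.
Hypothesis xsmin : is_minimizer (objective f) xs.
Variables (Om : finType) (p : Om -> R) (N tau : nat) (gamma : R) (x0 : 'rV[R]_d).
Variables (xh : nat -> Om -> 'rV[R]_d) (ix : nat -> Om -> 'I_n).
Hypotheses (p_ge0 : forall w, 0 <= p w) (p_sum : \sum_w p w = 1).
Hypothesis gamma_gt0 : 0 < gamma.

Let Ex (X : Om -> R) := \sum_w p w * X w.

(** Independence of the past in the form of a conditional mean: [Phi] sees reads up to [t] and
    indices before [t], so [ix t] can be averaged out. *)
Hypothesis sampling : forall t (Phi : Om -> 'I_n -> R), (t <= N)%N ->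
  (forall w w', (forall u, (u <= t)%N -> xh u w = xh u w') ->
     (forall u, (u < t)%N -> ix u w = ix u w') -> Phi w =1 Phi w') ->
  \sum_w p w * Phi w (ix t w) = \sum_w p w * (n%:R^-1 * \sum_j Phi w j).

Definition step_gradient t w := gradient (f (ix t w)) (xh t w).
Let g := step_gradient.

Definition virtual_iterate t w := x0 - gamma *: \sum_(u < t) step_gradient u w.
Let xv := virtual_iterate.

(** Restricted to [p w != 0], since only histories of positive mass are known to come from an actual
    run. *)
Hypothesis drift : forall t w v, (t <= N)%N -> p w != 0 ->
  `|(xh t w - virtual_iterate t w) ord0 v| <=
     gamma * \sum_(u < t | (t <= u + tau)%N) `|step_gradient u w ord0 v|.

Let ExD X Y : Ex (fun w => X w + Y w) = Ex X + Ex Y.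
Proof. by rewrite -big_split; apply: eq_bigr => w _; rewrite mulrDr. Qed.

Let ExZ k X : Ex (fun w => k * X w) = k * Ex X.
Proof. by rewrite mulr_sumr; apply: eq_bigr => w _; rewrite mulrCA. Qed.

Let Ex_cst k : Ex (fun=> k) = k.
Proof. by rewrite /Ex -mulr_suml p_sum mul1r. Qed.

Let Ex_sum (I : Type) (r : seq I) (P : pred I) (F : I -> Om -> R) :
  Ex (fun w => \sum_(i <- r | P i) F i w) = \sum_(i <- r | P i) Ex (F i).
Proof.
rewrite /Ex exchange_big /=; apply: eq_bigr => w _.
by rewrite mulr_sumr.
Qed.

Let Ex_le X Y : (forall w, p w != 0 -> X w <= Y w) -> Ex X <= Ex Y.
Proof.
move=> XY; apply: ler_sum => w _.
have [->|pw] := eqVneq (p w) 0; first by rewrite !mul0r.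
by rewrite ler_wpM2l ?p_ge0 // XY.
Qed.

Let Ex_ge0 X : (forall w, 0 <= X w) -> 0 <= Ex X.
Proof. by move=> X0; apply: sumr_ge0 => w _; rewrite mulr_ge0. Qed.

Let s := Num.sqrt (sparsity f).
Let s_gt0 : 0 < s. Proof. by rewrite sqrtr_gt0; exact: (sparsity_gt0 n0 d0 fsp). Qed.
Let ssE : s ^+ 2 = sparsity f. Proof. by rewrite sqr_sqrtr // sparsity_ge0. Qed.

Let q t := Ex (fun w => sqnorm (g t w)).
Let e t := Ex (fun w => objective f (xh t w) - objective f xs).
Let a t := Ex (fun w => sqnorm (xv t w - xs)).
Let win t (F : nat -> R) := \sum_(u < t | (t <= u + tau)%N) F u.

Let q_ge0 t : 0 <= q t. Proof. by apply: Ex_ge0 => w; exact: sqnorm_ge0. Qed.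
Let e_ge0 t : 0 <= e t.
Proof. by apply: Ex_ge0 => w; rewrite subr_ge0; exact: xsmin. Qed.

Let q_le t : (t <= N)%N -> q t <= 4 * L * e t + 2 * noise f xs.
Proof.
move=> tN.
have -> : q t = Ex (fun w => n%:R^-1 * \sum_j sqnorm (gradient (f j) (xh t w))).
  apply: (sampling (Phi := fun w j => sqnorm (gradient (f j) (xh t w)))) => //.
  by move=> w w' hx _ j; rewrite hx.
rewrite -[2 * noise f xs]Ex_cst -ExZ -ExD; apply: Ex_le => w _.
exact: (mean_sqnorm_gradient_le n0 d0 fsp).
Qed.

Let cross u t w := \sum_(v < d) `|g u w ord0 v| * `|g t w ord0 v|.

Let crossC u t w : cross u t w = cross t u w.
Proof. by apply: eq_bigr => v _; rewrite mulrC. Qed.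

(** [g u] belongs to the past of iteration [t], so the support indicator can be averaged over the
    index; each coordinate then has weight at most the sparsity. *)
Let masked_le u t : (u < t)%N -> (t <= N)%N ->
  Ex (fun w => \sum_(v < d) (v \in grad_support (f (ix t w)))%:R * g u w ord0 v ^+ 2)
    <= sparsity f * q u.
Proof.
move=> ut tN.
rewrite [leLHS](_ : _ = Ex (fun w => n%:R^-1 * \sum_j
    \sum_(v < d) (v \in grad_support (f j))%:R * g u w ord0 v ^+ 2)); last first.
  apply: (sampling (Phi := fun w j =>
    \sum_(v < d) (v \in grad_support (f j))%:R * g u w ord0 v ^+ 2)) => //.
  move=> w w' hx hi j; apply: eq_bigr => v _.
  by rewrite /g /step_gradient hx ?hi // ltnW.
rewrite -ExZ; apply: Ex_le => w _; rewrite exchange_big /= !mulr_sumr.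
apply: ler_sum => v _; rewrite -mulr_suml mulrA ler_wpM2r ?sqr_ge0 //.
exact: sparsity_count_le.
Qed.

(** [g t] vanishes off the support of the sampled function, so [g u] can be masked by that support.
    Young's inequality with weight [s] balances the gain [s ^+ 2] of the mask and leaves [s / 2] on
    both terms. *)
Let cross_lt_le u t : (u < t)%N -> (t <= N)%N -> Ex (cross u t) <= s / 2 * (q u + q t).
Proof.
move=> ut tN.
have : Ex (cross u t) <= Ex (fun w => s / 2 * sqnorm (g t w) + (2 * s)^-1 *
    \sum_(v < d) (v \in grad_support (f (ix t w)))%:R * g u w ord0 v ^+ 2).
  apply: Ex_le => w _; rewrite !mulr_sumr -big_split /=; apply: ler_sum => v _.
  have [vS|vS] := boolP (v \in grad_support (f (ix t w))); last first.
    by rewrite /(g t) /step_gradient (gradient_eq0 _ vS) normr0 expr0n !mulr0 mul0r mulr0 addr0.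
  rewrite mul1r -(normr_id (g u w ord0 v)) -(real_normK (num_real (g u w ord0 v))).
  rewrite -(real_normK (num_real (g t w ord0 v))) normr_id.
  set x := `|_|; set y := `|_|; rewrite -subr_ge0.
  have -> : s / 2 * y ^+ 2 + (2 * s)^-1 * x ^+ 2 - x * y = (s * y - x) ^+ 2 / (2 * s).
    by field; rewrite gt_eqF.
  by rewrite divr_ge0 ?sqr_ge0 // mulr_ge0 // ltW.
move=> /le_trans; apply; rewrite ExD !ExZ -/(q t).
have := masked_le ut tN; rewrite -ssE => h.
have : (2 * s)^-1 * Ex (fun w => \sum_(v < d)
   (v \in grad_support (f (ix t w)))%:R * g u w ord0 v ^+ 2) <=
   (2 * s)^-1 * (s ^+ 2 * q u).
  by rewrite ler_wpM2l // invr_ge0 mulr_ge0 // ltW.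
have -> : (2 * s)^-1 * (s ^+ 2 * q u) = s / 2 * q u by field; rewrite gt_eqF.
lra.
Qed.

Let cross_le u t : (u <= N)%N -> (t <= N)%N ->
  Ex (cross u t) <= (u == t)%:R * q u + s / 2 * (q u + q t).
Proof.
move=> uN tN; case: (ltngtP u t) => [ut|tu|<-].
- by rewrite mul0r add0r; exact: cross_lt_le.
- rewrite mul0r add0r addrC.
  have -> : Ex (cross u t) = Ex (cross t u) by apply: eq_bigr => w _; rewrite crossC.
  exact: cross_lt_le.
- rewrite mul1r; have -> : Ex (cross u u) = q u.
    apply: eq_bigr => w _; congr (_ * _); apply: eq_bigr => v _.
    by rewrite -expr2 real_normK // num_real.
  by rewrite lerDl mulr_ge0 // ?addr_ge0 // divr_ge0 // ltW.
Qed.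

Let win_card t k : 0 <= k -> win t (fun=> k) <= tau%:R * k.
Proof.
move=> k0; rewrite /win sumr_const -[k *+ _]mulr_natl ler_wpM2r // ler_nat.
exact: card_window.
Qed.

(** Squaring the windowed sum gives the terms [cross u u']: the diagonal yields [win t q], and the
    [s / 2] terms at most [s * tau] times it, as a window has at most [tau] elements. *)
Let drift_sqnorm t : (t <= N)%N ->
  Ex (fun w => sqnorm (xh t w - xv t w)) <=
    gamma ^+ 2 * (1 + s * tau%:R) * win t q.
Proof.
move=> tN.
have : Ex (fun w => sqnorm (xh t w - xv t w)) <=
    Ex (fun w => gamma ^+ 2 * \sum_(u < t | (t <= u + tau)%N)
         \sum_(u' < t | (t <= u' + tau)%N) cross u u' w).
  apply: Ex_le => w pw.
  rewrite /cross; under eq_bigr do rewrite exchange_big /=.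
  rewrite exchange_big /= mulr_sumr; apply: ler_sum => v _.
  rewrite -(real_normK (num_real _)).
  under eq_bigr do rewrite -mulr_sumr.
  rewrite -mulr_suml -expr2 -exprMn ler_sqr ?nnegrE ?normr_ge0 //.
    exact: drift.
  by rewrite mulr_ge0 ?(ltW gamma_gt0) // sumr_ge0.
move=> /le_trans; apply; rewrite ExZ -mulrA ler_wpM2l ?sqr_ge0 // Ex_sum.
have tN' (u : 'I_t) : (u <= N)%N by apply: leq_trans tN; exact: ltnW.
have : \sum_(u < t | (t <= u + tau)%N) Ex (fun w =>
      \sum_(u' < t | (t <= u' + tau)%N) cross u u' w) <=
   \sum_(u < t | (t <= u + tau)%N) (q u + s / 2 * (tau%:R * q u + win t q)).
  apply: ler_sum => u uw; rewrite Ex_sum.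
  apply: le_trans (ler_sum _ (fun u' _ => cross_le (tN' u) (tN' u'))) _.
  rewrite big_split /= -mulr_sumr big_split /=; apply: lerD.
    rewrite (bigD1 u) //= eqxx mul1r big1 ?addr0 // => u' /andP[_ uu'].
    by rewrite val_eqE eq_sym (negbTE uu') mul0r.
  by rewrite ler_wpM2l ?divr_ge0 ?(ltW s_gt0) // lerD2r; exact: win_card.
move=> /le_trans; apply.
have W0 : 0 <= win t q by apply: sumr_ge0.
rewrite big_split /= -mulr_sumr big_split /= -mulr_sumr -/(win t q).
have := win_card t W0; rewrite -/(win t _) => h.
have : s / 2 * win t (fun=> win t q) <= s / 2 * (tau%:R * win t q).
  by rewrite ler_wpM2l ?divr_ge0 ?(ltW s_gt0).
rewrite /win; nra.
Qed.

Let drift_dotv t : (t <= N)%N ->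
  Ex (fun w => dotv (xh t w - xv t w) (g t w)) <=
    gamma * (s / 2 * (win t q + tau%:R * q t)).
Proof.
move=> tN.
have : Ex (fun w => dotv (xh t w - xv t w) (g t w)) <=
    Ex (fun w => gamma * \sum_(u < t | (t <= u + tau)%N) cross u t w).
  apply: Ex_le => w pw; rewrite /cross exchange_big /= mulr_sumr.
  apply: ler_sum => v _; rewrite -mulr_suml mulrA.
  apply: le_trans (ler_norm _) _; rewrite normrM ler_wpM2r //.
  exact: drift.
move=> /le_trans; apply; rewrite ExZ ler_wpM2l ?(ltW gamma_gt0) // Ex_sum.
apply: (@le_trans _ _ (\sum_(u < t | (t <= u + tau)%N) (s / 2 * (q u + q t)))).
  by apply: ler_sum => u _; exact: cross_lt_le.
rewrite -mulr_sumr ler_wpM2l ?divr_ge0 ?(ltW s_gt0) // big_split /= lerD2l.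
exact: win_card.
Qed.

(** The read [xh t] precedes the draw of [ix t], so [g t] averages to the mean gradient at [xh t];
    strong convexity between [xh t] and [xs] gives the rest. *)
Let gradient_progress t : (t <= N)%N ->
  e t + mu / 2 * Ex (fun w => sqnorm (xh t w - xs)) <=
    Ex (fun w => dotv (xh t w - xs) (g t w)).
Proof.
move=> tN.
rewrite [leRHS](_ : _ = Ex (fun w => n%:R^-1 * \sum_j
    dotv (xh t w - xs) (gradient (f j) (xh t w)))); last first.
  apply: (sampling (Phi := fun w j =>
    dotv (xh t w - xs) (gradient (f j) (xh t w)))) => //.
  by move=> w w' hx _ j; rewrite hx.
rewrite -ExZ -ExD; apply: Ex_le => w _.
have := objective_strong_lower_bound fsp (xh t w) xs.
rewrite -[xs - xh t w]opprB dotvNr sqnormN dotv_mean_gradient.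
under eq_bigr do rewrite dotvC.
lra.
Qed.

(** Serves twice: as coefficient of the window in [drift_sqnorm], and as coefficient of [q t] in one
    step, where the part with [s * tau] comes from [drift_dotv]. *)
Let c1 := gamma ^+ 2 * (1 + s * tau%:R).
(** The first term comes from [drift_dotv], the second from moving strong convexity from the read to
    the virtual iterate. *)
Let c2 := gamma ^+ 2 * s + gamma * mu * c1.

Let virtual_step t : (t <= N)%N ->
  a t.+1 <= (1 - gamma * mu / 2) * a t + c1 * q t + c2 * win t q - 2 * gamma * e t.
Proof.
move=> tN.
have xvB w : (xh t w - xs) - (xh t w - xv t w) = xv t w - xs.
  by rewrite opprB addrC addrA subrK.
have xvS w : xv t.+1 w - xs =
    ((xh t w - xs) - (xh t w - xv t w)) - gamma *: g t w.
  by rewrite xvB /xv /virtual_iterate big_ord_recr /= scalerDr opprD addrA [LHS]addrAC.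
(* Strong convexity contracts at [xh t] while the recursion runs on [xv t]. The exchange halves the
   rate, whence [gamma * mu / 2], and adds the drift. *)
have half : a t / 2 - Ex (fun w => sqnorm (xh t w - xv t w)) <=
    Ex (fun w => sqnorm (xh t w - xs)).
  rewrite lerBlDr -ExD [a t / 2]mulrC -ExZ; apply: Ex_le => w _.
  rewrite -xvB.
  have := sqnormB_le (xh t w - xs) (xh t w - xv t w); lra.
have aS : a t.+1 = a t + gamma ^+ 2 * q t
    + 2 * gamma * Ex (fun w => dotv (xh t w - xv t w) (g t w))
    - 2 * gamma * Ex (fun w => dotv (xh t w - xs) (g t w)).
  rewrite -mulNr -!ExZ -!ExD; apply: eq_bigr => w _; congr (_ * _).
  rewrite xvS -[xv t w - xs]xvB.
  move: (xh t w - xs) (xh t w - xv t w) (g t w) => y z G.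
  by rewrite [sqnorm (_ - _ *: _)]sqnormB sqnormZ dotvZr dotvBl; ring.
have dd := drift_dotv tN; have ds := drift_sqnorm tN.
have gp := gradient_progress tN; have mu0 := fsp_mu_gt0 fsp.
have g0 := gamma_gt0.
set Xh := Ex (fun w => sqnorm (xh t w - xs)) in half gp.
set Dr := Ex (fun w => sqnorm (xh t w - xv t w)) in half ds.
set Dd := Ex (fun w => dotv (xh t w - xv t w) _) in aS dd.
set Pr := Ex (fun w => dotv (xh t w - xs) _) in aS gp.
have gp' : gamma * (e t + mu / 2 * Xh) <= gamma * Pr by rewrite ler_wpM2l // ltW.
have dd' : gamma * Dd <= gamma * (gamma * (s / 2 * (win t q + tau%:R * q t))).
  by rewrite ler_wpM2l // ltW.
have half' : gamma * mu * (a t / 2 - Dr) <= gamma * mu * Xh.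
  by rewrite ler_wpM2l // mulr_ge0 // ltW.
have ds' : gamma * mu * Dr <= gamma * mu * (c1 * win t q).
  by rewrite ler_wpM2l // mulr_ge0 // ltW.
have c1Q : c1 * q t = gamma ^+ 2 * q t + gamma ^+ 2 * (s * tau%:R) * q t.
  by rewrite /c1; ring.
rewrite aS /c2; move: gp' dd' half' ds' c1Q.
move: (a t) (q t) (win t q) (e t) c1 => A0 Q W E0 c.
lra.
Qed.

Hypothesis gamma_small : gamma * L * (5 * (1 + 2 * tau%:R * s)) <= 1.

Lemma finite_hogwild_bound t : (t <= N)%N ->
  Ex (fun w => sqnorm (xh t w - xs)) <=
    (1 - gamma * mu / 2) ^+ t * (2 * sqnorm (x0 - xs))
      + 20 * (1 + 2 * tau%:R * s) * (gamma * noise f xs / mu).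
Proof.
move=> tN.
have mu0 := fsp_mu_gt0 fsp; have L0 := lipschitz_gt0 n0 d0 fsp.
have muL := strong_convexity_le_sparsity n0 d0 fsp.
have D1 := sparsity_le1 f n0.
have g0 := gamma_gt0; have s0 := s_gt0.
pose z := tau%:R * s; have z0 : 0 <= z by rewrite mulr_ge0 // ltW.
have gL0 : 0 < gamma * L by rewrite mulr_gt0.
have zE : 2 * tau%:R * s = 2 * z by rewrite mulrA.
have gs : gamma * L * (5 * (1 + 2 * z)) <= 1 by rewrite -zE.
have gLz0 : 0 <= gamma * L * z by rewrite mulr_ge0 // ltW.
have gLz : gamma * L * z <= 1 / 10 by lra.
have gL5 : gamma * L <= 1 / 5 by lra.
have s1 : s <= 1 by rewrite -sqrtr1 ler_wsqrtr.
have muL1 : mu <= L by apply: le_trans muL _; rewrite -[leRHS]mul1r ler_wpM2r // ltW.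
(* By [mu <= s ^+ 2 * L] and [s <= 1], the left side is at most [gamma * L * z]. *)
have gmt : gamma * mu * tau%:R <= 1 / 10.
  apply: le_trans gLz; rewrite -!mulrA ler_wpM2l ?(ltW g0) //.
  apply: le_trans (ler_wpM2r (ler0n _ _) muL) _.
  rewrite -ssE /z [s ^+ 2 * L]mulrC -mulrA ler_wpM2l ?(ltW L0) //.
  by rewrite expr2 mulrC mulrA -[leRHS]mulr1 ler_wpM2l // mulr_ge0 // ltW.
have gm0 : 0 < gamma * mu by rewrite mulr_gt0.
have gm1 : gamma * mu <= 1 / 5 by apply: le_trans gL5; rewrite ler_wpM2l // ltW.
have N0 : 0 <= noise f xs.
  rewrite /noise mulr_ge0 ?invr_ge0 ?ler0n // sumr_ge0 // => i _; exact: sqnorm_ge0.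
have c1_ge0 : 0 <= c1 by rewrite mulr_ge0 ?sqr_ge0 // addr_ge0 // mulr_ge0 // ltW.
have c2_ge0 : 0 <= c2.
  apply: addr_ge0; first by rewrite mulr_ge0 ?sqr_ge0 // ltW.
  by rewrite mulr_ge0 // ltW.
(* The constant [M] of the delayed recursion, for [rho = gamma * mu / 2]. *)
set M := 2 * c1 + tau%:R * (10 / 9 * (c2 + gamma * mu / 2 * c1)).
have ME : M <= gamma ^+ 2 * (5 / 2 * (1 + 2 * z)).
  have -> : M = gamma ^+ 2 * (2 * (1 + z) + 10 / 9 *
     (z + 3 / 2 * (gamma * mu * tau%:R) * (1 + z))).
    by rewrite /M /c2 /c1 /z; field.
  rewrite ler_wpM2l ?sqr_ge0 //.
  have : gamma * mu * tau%:R * (1 + z) <= 1 / 10 * (1 + z).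
    by rewrite ler_wpM2r // addr_ge0.
  lra.
(* The step-size condition is used in full here: by [ME] the product is at most [2 * gamma] times
   the left side of [gs]. *)
have MA : M * (4 * L) <= 2 * gamma.
  apply: le_trans (ler_wpM2r _ ME) _; first by rewrite mulr_ge0 // ltW.
  have : gamma * (gamma * L * (5 * (1 + 2 * z))) <= gamma * 1.
    by rewrite ler_wpM2l ?(ltW g0).
  lra.
have rho0 : 0 < gamma * mu / 2 by rewrite divr_gt0.
have rho1 : gamma * mu / 2 <= 1 by lra.
have rhot : gamma * mu / 2 * tau%:R <= 1 / 10.
  have : 0 <= gamma * mu * tau%:R by rewrite mulr_ge0 // ltW.
  by lra.
have noise2 : 0 <= 2 * noise f xs by rewrite mulr_ge0.
have := delayed_recursion_bound rho0 rho1 rhot c1_ge0 c2_ge0 noise2 q_ge0 e_ge0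
  q_le virtual_step MA (leqW tN).
rewrite -/M -/(win t q) => key.
have a0 : a 0%N = sqnorm (x0 - xs).
  by rewrite -[RHS]Ex_cst; apply: eq_bigr => w _; rewrite /xv /virtual_iterate
    big_ord0 scaler0 subr0.
(* Returning to reads doubles the bound: hence the 2 before [sqnorm (x0 - xs)] and the passage from
   10 to 20 in the noise term. The drift is covered by the [c1] term of [key]. *)
have split2 : Ex (fun w => sqnorm (xh t w - xs)) <=
    2 * (a t + Ex (fun w => sqnorm (xh t w - xv t w))).
  rewrite -ExD -ExZ; apply: Ex_le => w _.
  have -> : xh t w - xs = (xv t w - xs) + (xh t w - xv t w).
    by rewrite [RHS]addrC addrA subrK.
  exact: sqnormD_le.
have ds := drift_sqnorm tN; rewrite -/c1 in ds.
have Mn : M * (2 * noise f xs) / (gamma * mu / 2) <=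
    10 * (1 + 2 * z) * (gamma * noise f xs / mu).
  have -> : 10 * (1 + 2 * z) * (gamma * noise f xs / mu) =
    gamma ^+ 2 * (5 / 2 * (1 + 2 * z)) * (2 * noise f xs) / (gamma * mu / 2).
    by field; rewrite !gt_eqF.
  by rewrite ler_wpM2r ?invr_ge0 ?(ltW rho0) // ler_wpM2r.
move: key; rewrite a0 => key; rewrite zE; lra.
Qed.

End finite_hogwild.

(** * From the run to a finite probability space *)

Section finite_valued.
Variables (R : realType) (disp : measure_display) (T : measurableType disp).
Variables (P : probability T R) (Om : finType) (Y : T -> Om).
Hypothesis mY : forall o, measurable [set w | Y w = o].

Definition fiber_mass o : R := fine (P [set w | Y w = o]).

Lemma fiber_mass_ge0 o : 0 <= fiber_mass o.
Proof. exact: fine_ge0. Qed.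

Lemma fiber_massE o : P [set w | Y w = o] = (fiber_mass o)%:E.
Proof. by rewrite fineK // fin_num_measure. Qed.

Lemma fiber_mass_attained o : fiber_mass o != 0 -> exists w, Y w = o.
Proof.
apply: contra_neqP => h; rewrite /fiber_mass.
rewrite (_ : [set w | Y w = o] = set0) ?measure0 // -subset0 => w /= Yw.
by apply: h; exists w.
Qed.

Lemma integral_finite_valued (X : Om -> R) : (forall o, 0 <= X o) ->
  (\int[P]_w (X (Y w))%:E = (\sum_o fiber_mass o * X o)%:E)%E.
Proof.
move=> X0.
have XE w : (X (Y w))%:E =
    (\sum_(o <- enum Om) (X o)%:E * (\1_[set w | Y w = o] w)%:E)%E.
  rewrite big_enum /= (bigD1 (Y w)) //= big1; last first.
    move=> o oY; rewrite indicE memNset ?mule0 //= => Yo.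
    by rewrite -Yo eqxx in oY.
  by rewrite adde0 indicE mem_set // mule1.
under eq_integral do rewrite XE.
rewrite ge0_integral_sum //; last 2 first.
- move=> o; apply: measurable_funeM.
  by apply/measurable_EFinP; exact: measurable_indic.
- by move=> o w _; rewrite mule_ge0 // lee_fin.
rewrite big_enum /= -sumEFin; apply: eq_bigr => o _.
rewrite ge0_integralZl_EFin //; last by apply/measurable_EFinP; exact: measurable_indic.
rewrite integral_indic // setIT mulrC EFinM; congr (_ * _)%E.
exact: fiber_massE.
Qed.

Lemma probability_finite_valued (Q : pred Om) :
  P [set w | Q (Y w)] = (\sum_(o | Q o) fiber_mass o)%:E.
Proof.
have mQ : measurable [set w | Q (Y w)].
  rewrite (_ : mkset _ = \bigcup_(o in [set o | Q o]) [set w | Y w = o]).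
    by apply: fin_bigcup_measurable => // o _; exact: mY.
  by apply/seteqP; split => [w Qw|w [y Qy Yy]]; [by exists (Y w)|by rewrite /= Yy].
rewrite -[X in P X]setIT -integral_indic //.
have E w : (\1_[set w | Q (Y w)] w)%:E = ((Q (Y w))%:R)%:E :> \bar R.
  case: (boolP (Q (Y w))) => Qw; rewrite indicE; first by rewrite mem_set.
  by rewrite memNset //=; exact/negP.
under eq_integral do rewrite E.
rewrite (integral_finite_valued (X := fun o => (Q o)%:R)) //.
congr EFin; rewrite [RHS]big_mkcond; apply: eq_bigr => o _.
by case: ifP => _; rewrite ?mulr1 ?mulr0.
Qed.

Lemma fiber_mass_sum : \sum_o fiber_mass o = 1.
Proof.
have := probability_finite_valued xpredT.
rewrite (_ : [set w | xpredT (Y w)] = setT); last by apply/seteqP; split.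
by rewrite probability_setT => -[].
Qed.

End finite_valued.

(** * Pathwise properties of a run: missing increments, finitely many reads *)

Section run_properties.
Variables (R : realType) (n d : nat) (f : 'I_n -> 'rV[R]_d -> R).
Variables (gamma : R) (tau : nat) (x0 : 'rV[R]_d).

(** Read and virtual iterate differ by the increments not yet written when [v] is read; bounded
    overlap places them among the last [tau] iterations. *)
Lemma run_drift (s : schedule R d) (xhat : nat -> 'rV[R]_d) (idx : nat -> 'I_n) t v :
  0 < gamma -> hogwild_run f gamma x0 s xhat idx -> bounded_overlap tau s ->
  `|(xhat t - (x0 - gamma *: \sum_(u < t) gradient (f (idx u)) (xhat u))) ord0 v| <=
    gamma * \sum_(u < t | (t <= u + tau)%N) `|gradient (f (idx u)) (xhat u) ord0 v|.
Proof.
move=> g0 run ov.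
rewrite !mxE (run_memory run) opprB addrC addrA subrK summxE.
under [X in _ - X]eq_bigr do rewrite mulrC.
rewrite -mulr_suml [X in _ - X]mulrC -mulrBr normrM gtr0_norm //.
rewrite ler_wpM2l ?(ltW g0) //.
rewrite [X in X - _](bigID (fun u : 'I_t => (v \in grad_support (f (idx u)))
  && (write_at s u v < read_at s t v))) /= [X in X - _]addrC addrK.
apply: le_trans (ler_norm_sum _ _ _) _.
rewrite big_mkcond [leRHS]big_mkcond /=; apply: ler_sum => u _.
have [vS|vS] := boolP (v \in grad_support (f (idx u))); last first.
  by rewrite gradient_eq0 // normr0 !if_same.
case: ifPn => [late|_]; last by case: ifP.
case: ifPn => //; rewrite -ltnNge => ut; exfalso.
move: late => /=; apply/negP; rewrite negbK.
have [_ ww] := run_write run vS.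
have [rr _] := run_read run t v.
have {}ut : (u + tau + 1 <= t)%N by rewrite addn1.
(* Either [u] ends before [t] starts, and its write is visible, or [t] ends before [u] starts,
   against the order of completed reads. *)
have [h|h] := ov u t ut.
  exact: (le_lt_trans ww (lt_le_trans h rr)).
have [r1 r2] := run_read run u v.
have le1 := run_labeling run (ltnW (ltn_ord u)).
have le2 := run_read_write_end run t.
have := lt_le_trans (le_lt_trans (le_trans le1 le2) h) (le_trans r1 r2).
by rewrite ltxx.
Qed.

(** By induction, a read is determined by the earlier reads and indices and by the set of visible
    coordinate writes. This leaves finitely many values, uniformly in the outcome and whatever the
    schedule. *)
Lemma run_finite_range (T : Type) (s : T -> schedule R d)
    (xhat : nat -> T -> 'rV[R]_d) (idx : nat -> T -> 'I_n) (N : nat) :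
  (forall w, hogwild_run f gamma x0 (s w) (xhat^~ w) (idx^~ w)) ->
  exists F : seq 'rV[R]_d, forall t w, (t <= N)%N -> xhat t w \in F.
Proof.
move=> run.
suff [F hF] : exists F : seq 'rV[R]_d, forall t w, (t < N.+1)%N -> xhat t w \in F.
  by exists F.
elim: N.+1 => {N} [|N [F hF]]; first by exists [::].
(* [h.1] holds the read and index of each earlier iteration, [h.2] the coordinates whose writes are
   visible. *)
pose val_of (h : {ffun 'I_N -> seq_sub F * 'I_n} * {ffun 'I_N -> {set 'I_d}}) :=
  \row_(v < d) (x0 ord0 v - \sum_(u < N | v \in h.2 u)
     gamma * gradient (f (h.1 u).2) (val (h.1 u).1) ord0 v).
exists (F ++ codom val_of) => t w; rewrite ltnS leq_eqVlt mem_cat => /orP[/eqP->|tN].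
  apply/orP; right; apply/codomP.
  exists ([ffun u : 'I_N => (SeqSub (hF u w (ltn_ord u)), idx u w)],
    [ffun u : 'I_N => finset (fun v => (v \in grad_support (f (idx u w)))
                    && (write_at (s w) u v < read_at (s w) N v))]).
  apply/rowP => v; rewrite mxE (run_memory (run w)); congr (_ - _).
  by apply: eq_big => [u|u _]; rewrite !ffunE ?inE.
by rewrite hF.
Qed.

End run_properties.

(** * Histories and independence of the sampled index *)

Section history.
Variables (R : realType) (n d : nat) (disp : measure_display) (T : measurableType disp).
Variables (P : probability T R) (xhat : nat -> T -> 'rV[R]_d) (idx : nat -> T -> 'I_n).
Hypothesis us : uniform_sampling P xhat idx.
Variables (N : nat) (F : seq 'rV[R]_d) (y0 : seq_sub F) (i0 : 'I_n).
Hypothesis hF : forall t w, (t <= N)%N -> xhat t w \in F.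

Let Om := {ffun 'I_N.+1 -> seq_sub F * 'I_n}.

(** The default [y0] is never reached, since [hF] puts every read up to [N] in [F]. *)
Definition history w : Om := [ffun k : 'I_N.+1 => (insubd y0 (xhat k w), idx k w)].

(** Overwrites with defaults what is not past at the completed read [t]: reads after [t], indices
    from [t] on, as in [past_events]. *)
Definition past_of t (o : Om) : Om :=
  [ffun k : 'I_N.+1 => (if (k <= t)%N then (o k).1 else y0,
                        if (k < t)%N then (o k).2 else i0)].

Definition read_of u (o : Om) : 'rV[R]_d := val (o (inord u)).1.
Definition index_of u (o : Om) : 'I_n := (o (inord u)).2.

Lemma read_of_history u w : (u <= N)%N -> read_of u (history w) = xhat u w.
Proof. by move=> uN; rewrite /read_of ffunE /= inordK // insubdK // hF. Qed.

Lemma index_of_history u w : (u <= N)%N -> index_of u (history w) = idx u w.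
Proof. by move=> uN; rewrite /index_of ffunE /= inordK. Qed.

Lemma read_of_past u t o : (u <= t)%N -> (t <= N)%N -> read_of u (past_of t o) = read_of u o.
Proof.
move=> ut tN; rewrite /read_of ffunE /= inordK ?ut //.
by rewrite ltnS (leq_trans ut).
Qed.

Lemma index_of_past u t o : (u < t)%N -> (t <= N)%N -> index_of u (past_of t o) = index_of u o.
Proof.
move=> ut tN; rewrite /index_of ffunE /= inordK ?ut //.
by rewrite ltnS (leq_trans (ltnW ut)).
Qed.

Lemma past_event_xhat t u x : (u <= t)%N ->
  (past_events xhat idx t).-sigma.-measurable [set w | xhat u w = x].
Proof.
move=> ut.
rewrite (_ : mkset _ = \bigcap_(v in [set: 'I_d]) [set w | xhat u w ord0 v = x ord0 v]).
  apply: fin_bigcap_measurable => // v _; apply: sub_sigma_algebra; left.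
  by exists u, v, [set x ord0 v]; split => //; exact: measurable_set1.
apply/seteqP; split => [w /= E v _|w h /=]; first by rewrite /= E.
by apply/rowP => v; exact: h.
Qed.

Lemma past_event_idx t u j : (u < t)%N ->
  (past_events xhat idx t).-sigma.-measurable [set w | idx u w = j].
Proof. by move=> ut; apply: sub_sigma_algebra; right; exists u, j. Qed.

Lemma past_event_measurable t (A : set T) :
  (past_events xhat idx t).-sigma.-measurable A -> disp.-measurable A.
Proof.
apply: smallest_sub; first exact: sigma_algebra_measurable.
move=> B [[u [v [D [_ mD ->]]]]|[u [j [_ ->]]]].
  have := samp_xhat_measurable us u v measurableT mD.
  by rewrite setTI.
exact: (samp_idx_measurable us).
Qed.

Lemma insubd_eq u w (y : seq_sub F) : (u <= N)%N ->
  (insubd y0 (xhat u w) = y) <-> (xhat u w = val y).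
Proof.
move=> uN; split=> [<-|E]; first by rewrite insubdK // hF.
by apply: val_inj; rewrite insubdK // hF.
Qed.

(** Stated for the past sigma-algebra, on which [samp_independent] acts. Each overwritten entry
    imposes a condition that is always or never true. *)
Lemma past_of_history_measurable t h : (t <= N)%N ->
  (past_events xhat idx t).-sigma.-measurable [set w | past_of t (history w) = h].
Proof.
move=> tN; rewrite (_ : mkset _ = \bigcap_(k in [set: 'I_N.+1])
    ([set w | (if (k <= t)%N then insubd y0 (xhat k w) else y0) = (h k).1] `&`
     [set w | (if (k < t)%N then idx k w else i0) = (h k).2])).
  apply: fin_bigcap_measurable => // k _; apply: measurableI.
    case: (boolP (k <= t)%N) => kt; last first.
      have [->|ne] := eqVneq y0 (h k).1.
        by rewrite (_ : mkset _ = setT); [exact: measurableT|apply/seteqP; split].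
      rewrite (_ : mkset _ = set0); first exact: measurable0.
      by apply/seteqP; split => // w /= E; rewrite E eqxx in ne.
    rewrite (_ : mkset _ = [set w | xhat k w = val (h k).1]); first exact: past_event_xhat.
    by apply/seteqP; split => w /insubd_eq; apply; rewrite -ltnS.
  case: (boolP (k < t)%N) => kt; first exact: past_event_idx.
  have [->|ne] := eqVneq i0 (h k).2.
    by rewrite (_ : mkset _ = setT); [exact: measurableT|apply/seteqP; split].
  rewrite (_ : mkset _ = set0); first exact: measurable0.
  by apply/seteqP; split => // w /= E; rewrite E eqxx in ne.
apply/seteqP; split => [w /= <- k _|w hw /=].
  by rewrite !ffunE.
apply/ffunP => k; have [/= h1 h2] := hw k I.
by rewrite !ffunE /= h1 h2; case: (h k).
Qed.

Lemma history_measurable o : measurable [set w | history w = o].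
Proof.
rewrite (_ : mkset _ = \bigcap_(k in [set: 'I_N.+1])
    ([set w | xhat k w = val (o k).1] `&` [set w | idx k w = (o k).2])).
  apply: fin_bigcap_measurable => // k _; apply: measurableI.
    by apply: (@past_event_measurable k); exact: past_event_xhat.
  exact: (samp_idx_measurable us).
apply/seteqP; split => [w /= <- k _|w hw /=].
  by rewrite /= !ffunE /= insubdK ?hF // -ltnS.
apply/ffunP => k; have [/= h1 h2] := hw k I.
rewrite !ffunE h2; case: (o k) h1 => y j /= h1; congr pair.
by apply/insubd_eq; rewrite // -ltnS.
Qed.

(** Histories are grouped by their past, which determines [Phi]; within a group, independence gives
    each index the share [n%:R^-1] of the mass. *)
Lemma history_sampling t (Phi : Om -> 'I_n -> R) : (t <= N)%N ->
  (forall o o', (forall u, (u <= t)%N -> read_of u o = read_of u o') ->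
     (forall u, (u < t)%N -> index_of u o = index_of u o') -> Phi o =1 Phi o') ->
  \sum_o fiber_mass P history o * Phi o (index_of t o) =
  \sum_o fiber_mass P history o * (n%:R^-1 * \sum_j Phi o j).
Proof.
move=> tN inv.
have PhiE o : Phi o =1 Phi (past_of t o).
  by apply: inv => u ut; rewrite ?read_of_past ?index_of_past.
have mass h j : \sum_(o | (past_of t o == h) && (index_of t o == j)) fiber_mass P history o
    = n%:R^-1 * \sum_(o | past_of t o == h) fiber_mass P history o.
  apply: EFin_inj; rewrite EFinM.
  rewrite -(probability_finite_valued P history_measurable
    (fun o => (past_of t o == h) && (index_of t o == j))).
  rewrite -(probability_finite_valued P history_measurable (fun o => past_of t o == h)).
  rewrite -(samp_uniform us t j) muleC.
  have -> : [set w | past_of t (history w) == h] = [set w | past_of t (history w) = h].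
    by apply/seteqP; split => w /= /eqP.
  rewrite -(samp_independent us j (past_of_history_measurable h tN)); congr (P _).
  apply/seteqP; split => w /=.
    by rewrite index_of_history // => /andP[/eqP ? /eqP].
  by rewrite index_of_history // => -[/eqP -> /eqP].
transitivity (\sum_h \sum_j Phi h j *
    \sum_(o | (past_of t o == h) && (index_of t o == j)) fiber_mass P history o).
  rewrite [LHS](partition_big (past_of t) xpredT) //=; apply: eq_bigr => h _.
  rewrite [LHS](partition_big (index_of t) xpredT) //=; apply: eq_bigr => j _.
  rewrite mulr_sumr; apply: eq_bigr => o /andP[/eqP <- /eqP <-].
  by rewrite -PhiE mulrC.
rewrite [RHS](partition_big (past_of t) xpredT) //=; apply: eq_bigr => h _.
rewrite (eq_bigr (fun o => fiber_mass P history o * (n%:R^-1 * \sum_j Phi h j))); last first.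
  move=> o /eqP <-; congr (_ * (_ * _)); apply: eq_bigr => j _; exact: PhiE.
rewrite -[RHS]mulr_suml [RHS]mulrA [RHS]mulrC [RHS]mulr_suml; apply: eq_bigr => j _.
by rewrite mass [X in Phi h j * X]mulrC.
Qed.

End history.

(** * Step-size condition and transfer of the finite bound *)

Section hogwild_convergence.
Variables (R : realType) (n d : nat) (f : 'I_n -> 'rV[R]_d -> R) (L mu : R).
Hypotheses (n0 : (0 < n)%N) (d0 : (0 < d)%N) (fsp : finite_sum_problem f L mu).

(** The square root is at least 1, its argument being 1 plus a nonnegative term. *)
Lemma astar_denominator_ge (tau : nat) :
  5 * (1 + 2 * tau%:R * Num.sqrt (sparsity f)) <=
  5 * (1 + 2 * tau%:R * Num.sqrt (sparsity f))
     * Num.sqrt (1 + 1 / (2 * (L / mu)) *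
                     Num.min (1 / Num.sqrt (sparsity f)) tau%:R).
Proof.
have L0 := lipschitz_gt0 n0 d0 fsp; have mu0 := fsp_mu_gt0 fsp.
apply: ler_peMr; first by rewrite mulr_ge0 // addr_ge0 // !mulr_ge0 // sqrtr_ge0.
rewrite -{1}sqrtr1 ler_wsqrtr // lerDl; apply: mulr_ge0.
  by rewrite divr_ge0 // mulr_ge0 // divr_ge0 // ltW.
by rewrite le_min ler0n andbT divr_ge0 // sqrtr_ge0.
Qed.

Lemma step_size_small (tau : nat) (gamma : R) :
  gamma <= astar (L / mu) (sparsity f) tau / L ->
  gamma * L * (5 * (1 + 2 * tau%:R * Num.sqrt (sparsity f))) <= 1.
Proof.
have L0 := lipschitz_gt0 n0 d0 fsp.
rewrite ler_pdivlMr // => h.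
have := astar_denominator_ge tau; move: h; rewrite /astar.
set A := 5 * _; set B := A * _ => h AB.
have A0 : 0 < A.
  by rewrite mulr_gt0 // ltr_wpDr // !mulr_ge0 // sqrtr_ge0.
have B0 : 0 < B by apply: lt_le_trans AB.
apply: le_trans (ler_wpM2r (ltW A0) h) _.
by rewrite mulrC ler_pdivrMr // mul1r.
Qed.

Lemma hogwild_bound (xs : 'rV[R]_d) (tau : nat) (gamma : R)
    (disp : measure_display) (T : measurableType disp) (P : probability T R)
    (x0 : 'rV[R]_d) (s : T -> schedule R d)
    (xhat : nat -> T -> 'rV[R]_d) (idx : nat -> T -> 'I_n) (t : nat) :
  is_minimizer (objective f) xs -> 0 < gamma ->
  gamma * L * (5 * (1 + 2 * tau%:R * Num.sqrt (sparsity f))) <= 1 ->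
  hogwild P f gamma tau x0 s xhat idx ->
  ('E_P[fun w => sqnorm (xhat t w - xs)] <=
     ((1 - gamma * mu / 2) ^+ t * (2 * sqnorm (x0 - xs))
       + 20 * (1 + 2 * tau%:R * Num.sqrt (sparsity f)) * (gamma * noise f xs / mu))%:E)%E.
Proof.
move=> xsmin g0 gs hog; have us := hogwild_sampling hog.
have [F hF] := run_finite_range t (hogwild_runs hog).
pose y0 : seq_sub F := SeqSub (hF t point (leqnn t)).
pose i0 : 'I_n := Ordinal n0.
pose Y : T -> _ := history xhat idx t y0.
pose xh := @read_of R n d t F; pose ix := @index_of R n d t F.
have mY : forall o, measurable [set w | Y w = o] := history_measurable us y0 hF.
have -> : ('E_P[fun w => sqnorm (xhat t w - xs)] =
    (\sum_o fiber_mass P Y o * sqnorm (xh t o - xs))%:E)%E.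
  rewrite unlock -(integral_finite_valued P mY (X := fun o => sqnorm (xh t o - xs))).
    by apply: eq_integral => w _; rewrite /xh read_of_history.
  by move=> o; exact: sqnorm_ge0.
rewrite lee_fin.
apply: (finite_hogwild_bound n0 d0 fsp xsmin (N := t) (ix := ix)) => //.
- by move=> o; exact: fiber_mass_ge0.
- exact: fiber_mass_sum.
- by move=> u Phi ut; exact: (history_sampling us y0 i0 hF).
(* A history of positive mass is that of some outcome [w], whose run satisfies [run_drift]. *)
move=> u o v ut /fiber_mass_attained[w <-].
have E (k : 'I_u) : step_gradient f xh ix k (Y w) =
    gradient (f (idx k w)) (xhat k w).
  have kt : (k <= t)%N by apply: leq_trans ut; exact: ltnW.
  by rewrite /step_gradient /xh /ix read_of_history // index_of_history.
have := run_drift u v g0 (hogwild_runs hog w) (hogwild_overlap hog w).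
rewrite /virtual_iterate {1}/xh read_of_history //.
under [X in gamma *: X]eq_bigr do rewrite -E.
by under [X in _ <= gamma * X]eq_bigr do rewrite -E.
Qed.

End hogwild_convergence.

Theorem corollary23 (R : realType) (K : R) (hK : 0 < K) :
  exists c C : R, 0 < c /\ 0 < C /\
  forall (n d : nat) (f : 'I_n -> 'rV[R]_d -> R) (L mu : R)
      (xs : 'rV[R]_d) (tau : nat),
    (0 < n)%N -> (0 < d)%N ->
    finite_sum_problem f L mu ->
    is_minimizer (objective f) xs ->
    tau%:R <= K * Num.min (1 / Num.sqrt (sparsity f)) (L / mu) ->
    (forall gamma : R, 0 < gamma ->
       gamma <= astar (L / mu) (sparsity f) tau / L ->
       forall (disp : measure_display) (T : measurableType disp)
         (P : probability T R) (x0 : 'rV[R]_d) (s : T -> schedule R d)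
         (xhat : nat -> T -> 'rV[R]_d) (idx : nat -> T -> 'I_n),
         hogwild P f gamma tau x0 s xhat idx ->
         forall t : nat,
           ('E_P[fun w => sqnorm (xhat t w - xs)] <=
             ((1 - gamma * mu / 2) ^+ t * (2 * sqnorm (x0 - xs))
               + C * (gamma * noise f xs / mu))%:E)%E)
    /\ (c <= astar (L / mu) (sparsity f) tau
        /\ 0 < c / L
        /\ c / L <= astar (L / mu) (sparsity f) tau / L
        /\ astar (L / mu) (sparsity f) tau / L <= 1 / (2 * L)).
Proof.
have K1 : 0 < 1 + 2 * K by lra.
(* [tau * sqrt Delta <= K] yields the factor [1 + 2 * K] in both constants; the last 2 in [c] bounds
   the square root in [astar]. *)
exists (5 * (1 + 2 * K) * 2)^-1, (20 * (1 + 2 * K)).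
have c0 : 0 < (5 * (1 + 2 * K) * 2)^-1 by rewrite invr_gt0 !mulr_gt0.
split; first by [].
split; first by rewrite mulr_gt0.
move=> n d f L mu xs tau n0 d0 fsp xsmin htau.
have L0 := lipschitz_gt0 n0 d0 fsp; have mu0 := fsp_mu_gt0 fsp.
have D0 := sparsity_gt0 n0 d0 fsp; have D1 := sparsity_le1 f n0.
have muL := strong_convexity_le_sparsity n0 d0 fsp.
have s0 : 0 < Num.sqrt (sparsity f) by rewrite sqrtr_gt0.
have zK : tau%:R * Num.sqrt (sparsity f) <= K.
  rewrite -ler_pdivlMr //; apply: le_trans htau _.
  by rewrite ler_wpM2l ?(ltW hK) // ge_min div1r lexx.
have z0 : 0 <= tau%:R * Num.sqrt (sparsity f) by rewrite mulr_ge0 // ltW.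
split.
  move=> gamma g0 gs disp T P x0 s xhat idx hog t.
  have small := step_size_small n0 d0 fsp gs.
  apply: le_trans (hogwild_bound n0 d0 fsp t xsmin g0 small hog) _.
  rewrite lee_fin lerD2l ler_wpM2r //.
    rewrite !mulr_ge0 ?invr_ge0 ?(ltW g0) ?(ltW mu0) ?ler0n //.
    by apply: sumr_ge0 => i _; exact: sqnorm_ge0.
  by rewrite ler_wpM2l // lerD2l -mulrA ler_wpM2l.
have den := astar_denominator_ge n0 d0 fsp tau.
have A5 : 5 <= 5 * (1 + 2 * tau%:R * Num.sqrt (sparsity f)) by rewrite -mulrA; lra.
have c0' : 0 < 5 * (1 + 2 * K) * 2 by rewrite -invr_gt0.
set den_astar := (X in _ <= X) in den.
have den0 : 0 < den_astar by apply: lt_le_trans (le_trans A5 den).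
have aE : astar (L / mu) (sparsity f) tau = den_astar^-1 by [].
have c_le : (5 * (1 + 2 * K) * 2)^-1 <= astar (L / mu) (sparsity f) tau.
  rewrite aE lef_pV2 ?posrE //.
  apply: ler_pM; rewrite ?sqrtr_ge0 //.
  - by rewrite ler_wpM2l // lerD2l -mulrA ler_wpM2l.
  apply: le_trans (_ : Num.sqrt (2 ^+ 2) <= _); last by rewrite sqrtr_sqr ger0_norm.
  rewrite ler_wsqrtr //.
  have : 1 / (2 * (L / mu)) * Num.min (1 / Num.sqrt (sparsity f)) tau%:R <= 1.
    (* Once the minimum is replaced by [1 / sqrt Delta], [mu <= Delta * L] bounds the term by
       [sqrt Delta / 2], whatever [kappa] is. *)
    apply: (@le_trans _ _ (1 / (2 * (L / mu)) * (1 / Num.sqrt (sparsity f)))).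
      rewrite ler_wpM2l ?ge_min ?lexx //.
      by rewrite divr_ge0 // mulr_ge0 // divr_ge0 // ltW.
    have -> : 1 / (2 * (L / mu)) * (1 / Num.sqrt (sparsity f)) =
       mu / (2 * L * Num.sqrt (sparsity f)).
      by field; rewrite !gt_eqF.
    rewrite ler_pdivrMr ?mulr_gt0 // mul1r.
    apply: le_trans muL _.
    have E : sparsity f = Num.sqrt (sparsity f) ^+ 2 by rewrite sqr_sqrtr // ltW.
    have s1 : Num.sqrt (sparsity f) <= 1 by rewrite -sqrtr1 ler_wsqrtr.
    have Ls : 0 < L * Num.sqrt (sparsity f) by rewrite mulr_gt0.
    have := ler_wpM2r (ltW Ls) s1; rewrite mul1r.
    have -> : sparsity f * L = Num.sqrt (sparsity f) * (L * Num.sqrt (sparsity f)).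
      by rewrite {1}E; ring.
    lra.
  lra.
split; first by [].
split; first by rewrite divr_gt0.
split; first by rewrite ler_wpM2r // invr_ge0 ltW.
(* Comparison with the serial range: the denominator of [astar] is at least 5, hence at least 2. *)
have -> : 1 / (2 * L) = 2^-1 / L by field; rewrite gt_eqF.
rewrite ler_wpM2r ?invr_ge0 ?(ltW L0) // aE lef_pV2 ?posrE //.
by apply: le_trans (le_trans A5 den); lra.
Qed.
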